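(* For any Banach space $X$ with $\dim X\ge 2$ and any $p\in[1,\infty)$, $$2^{1-p}\cdot 3^{p}\le G_L(X,p)\le 2^{p+1}.$$
   Context: For a Banach space $X$ with $\dim X\ge 2$ and $p\in[1,\infty)$, the constant $G_L(X,p)$ is defined by $$G_L(X,p)=\sup\{\|x+y\|^{p}+\|2x-y\|^{p}: x,y\in X,\ \|x\|=\|y\|=\|x-y\|=1\}.$$ *)

(* Defs.v *)
From HB Require Import structures.
From mathcomp Require Import all_boot all_order all_algebra.
From mathcomp Require Import all_classical all_reals all_analysis.

Set Implicit Arguments.
Unset Strict Implicit.
Unset Printing Implicit Defensive.

Import Order.TTheory GRing.Theory Num.Theory.
Import numFieldNormedType.Exports.

Local Open Scope classical_set_scope.
Local Open Scope ring_scope.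

(* [dim V >= n] for a possibly infinite-dimensional [V]: existence of [n]
   linearly independent vectors. *)
Definition dim_ge (K : fieldType) (V : lmodType K) (n : nat) : Prop :=
  exists e : 'I_n -> V,
    forall c : 'I_n -> K, \sum_(i < n) c i *: e i = 0 -> forall i, c i = 0.

(* The supremum is taken in [\bar R], so that it is the actual least upper
   bound of the set, with no convention for empty or unbounded sets of reals. *)
Definition GL (R : realType) (X : normedModType R) (p : R) : \bar R :=
  ereal_sup [set z | exists x y : X,
    [/\ `|x| = 1, `|y| = 1, `|x - y| = 1 &
        z = (`|x + y| `^ p + `|2 *: x - y| `^ p)%:E]].

(* Main.v *)
Require Import Defs.
From HB Require Import structures.
From mathcomp Require Import all_boot all_order all_algebra.
From mathcomp Require Import all_classical all_reals all_analysis.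
From mathcomp Require Import ring lra.
Import Order.TTheory GRing.Theory Num.Theory.
Import numFieldNormedType.Exports.
Local Open Scope ring_scope.

(** Write [u = x + y] and [v = 2 x - y = x + (x - y)].  When [x], [y] and
    [x - y] are unit vectors, both [u] and [v] are sums of two unit vectors, so
    their norms are at most [2]; this is the upper bound.

    For the lower bound, [u + v = 3 x] has norm [3], so the norms of [u] and
    [v] add up to at least [3].  Convexity of [t |-> t ^ p] then gives
    [|u| ^ p + |v| ^ p >= 2 (3 / 2) ^ p = 2 ^ (1 - p) 3 ^ p]
    ([power_mean_powR]).  The bound holds at every admissible pair, so it bounds
    the supremum from below as soon as one admissible pair exists
    ([exists_unit_equilateral], applied to the vectors supplied by
    [dim_ge2_unit_noncollinear]).  This is where dimension at least two enters:
    the unit sphere contains a path from [x] to [- x], along which the distance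
    to [x] goes from [0] to [2] and hence takes the value [1]. *)

(** This is convexity of the power function at the midpoint of [a] and [b], in
    the normalisation that yields the constant of the lower bound when
    [a + b = 3]. *)
Lemma power_mean_powR (R : realType) (p a b : R) :
  1 <= p -> 0 <= a -> 0 <= b ->
  2 `^ (1 - p) * (a + b) `^ p <= a `^ p + b `^ p.
Proof.
move=> p1 a0 b0.
have h0 : 0 <= (2^-1 : R) by lra.
have h1 : (2^-1 : R) <= 1 by lra.
have half : 1 - 2^-1 = 2^-1 :> R by lra.
have mid : (2^-1 * (a + b)) `^ p <= 2^-1 * (a `^ p + b `^ p).
  (* Convexity weighs the two points by [2^-1] and [1 - 2^-1]. *)
  rewrite !mulrDr -[X in _ + X * b]half -[X in _ <= _ + X * _]half.
  by apply: (@convex_powR R p p1 (Itv01 h0 h1)); rewrite inE /= in_itv /= andbT.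
rewrite powRM ?addr_ge0// in mid.
rewrite powRB ?pnatr_eq0 ?implybT// powRr1// -mulrA -ler_pdivlMl//.
by rewrite -powRN -mulN1r powRrM powR_inv1.
Qed.

(** The curve [v t = t x + (1 - t ^ 2) e] runs from [- x] at [t = -1] to [x] at
    [t = 1] and avoids the origin because [e] is not a multiple of [x].  Its
    radial projection to the unit sphere is continuous, and the distance from it
    to [x] falls from [2] to [0], so it equals [1] somewhere. *)
Lemma exists_unit_equilateral (R : realType) (X : normedModType R) (x e : X) :
  `|x| = 1 -> (forall t : R, e <> t *: x) ->
  exists y : X, `|y| = 1 /\ `|x - y| = 1.
Proof.
move=> x1 ex.
pose v (t : R) : X := t *: x + (1 - t ^+ 2) *: e.
have x0 : x != 0 by rewrite -normr_eq0 x1 oner_eq0.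
have v0 t : v t != 0.
  apply/eqP => /eqP; rewrite /v addrC addr_eq0 => /eqP vt0.
  (* When the coefficient of [e] vanishes, what is left is [t *: x], and
     [t = 0] would give [1 = 0]; otherwise [e] would be a multiple of [x]. *)
  have [t1|t1] := eqVneq (1 - t ^+ 2) 0.
    move/eqP: vt0; rewrite t1 scale0r eq_sym oppr_eq0 scaler_eq0 (negPf x0) orbF.
    by move/eqP => t0; move/eqP: t1; rewrite t0 expr0n subr0 oner_eq0.
  apply: (ex (- (t / (1 - t ^+ 2)))).
  apply: (scalerI t1); rewrite vt0 scalerA -scaleNr; congr (_ *: _).
  by field.
pose y (t : R) : X := `|v t|^-1 *: v t.
have y1 t : `|y t| = 1.
  by rewrite normrZ normfV normr_id mulVf// normr_eq0.
have cv : continuous v.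
  move=> t; apply: cvgD; first exact: cvgZr_tmp.
  by apply: cvgZr_tmp; apply: cvgB; [exact: cvg_cst|exact: exprn_continuous].
pose d (t : R) : R := `|x - y t|.
have cd : continuous d.
  move=> t; apply: cvg_norm; apply: cvgB; first exact: cvg_cst.
  apply: cvgZ; last exact: cv.
  by apply: cvgV; [rewrite normr_eq0|apply: cvg_norm; exact: cv].
have d1 : d 1 = 0.
  by rewrite /d /y /v expr1n subrr scale0r addr0 scale1r x1 invr1 scale1r subrr normr0.
have dN1 : d (- 1) = 2.
  rewrite /d /y /v sqrrN expr1n subrr scale0r addr0 scaleN1r normrN x1 invr1.
  by rewrite scale1r opprK -mulr2n normrMn x1.
have [t _ dt] : exists2 t, t \in `[-1, 1] & d t = 1.
  apply: IVT.
  - by lra.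
  - exact: continuous_subspaceT.
  - by rewrite d1 dN1 ge_min le_max; apply/andP; split; apply/orP; [right|left]; lra.
by exists (y t).
Qed.

Lemma dim_ge2_unit_noncollinear (R : realType) (X : normedModType R) :
  dim_ge X 2 -> exists x e : X, `|x| = 1 /\ forall t : R, e <> t *: x.
Proof.
move=> dimX.
have [b b_free] := dimX.
have b0 : b ord0 != 0.
  apply/eqP => b0; pose c (i : 'I_2) : R := if i == ord0 then 1 else 0.
  have /b_free/(_ ord0)/eqP : \sum_(i < 2) c i *: b i = 0.
    by rewrite !big_ord_recl big_ord0 /c /= b0 scaler0 scale0r !addr0.
  by rewrite /c /= oner_eq0.
exists (`|b ord0|^-1 *: b ord0), (b ord_max); split.
  by rewrite normrZ normfV normr_id mulVf// normr_eq0.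
move=> t bt.
pose c (i : 'I_2) : R := if i == ord0 then - (t * `|b ord0|^-1) else 1.
have /b_free/(_ ord_max)/eqP : \sum_(i < 2) c i *: b i = 0.
  rewrite !big_ord_recl big_ord0 /c /= addr0 scale1r.
  rewrite (_ : lift ord0 ord0 = ord_max); last exact/val_inj.
  by rewrite bt scalerA scaleNr addNr.
by rewrite /c /= oner_eq0.
Qed.

Theorem proposition4p1 (R : realType) (X : completeNormedModType R)
    (dimX : dim_ge X 2) (p : R) (p_ge1 : 1 <= p) :
  ((2 `^ (1 - p) * 3 `^ p)%:E <= GL X p)%E /\ (GL X p <= (2 `^ (p + 1))%:E)%E.
Proof.
have p0 : 0 <= p by lra.
have split2 (x y : X) : 2 *: x - y = x + (x - y).
  by rewrite scaler_nat mulr2n addrA.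
split.
- have [x [e [x1 ex]]] := dim_ge2_unit_noncollinear _ _ dimX.
  have [y [y1 xy1]] := exists_unit_equilateral _ _ _ _ x1 ex.
  apply: (@le_trans _ _ (`|x + y| `^ p + `|2 *: x - y| `^ p)%:E); last first.
    by apply: ereal_sup_ubound; exists x, y.
  rewrite lee_fin; apply: le_trans (power_mean_powR _ _ _ _ p_ge1 _ _) => //.
  rewrite ler_wpM2l ?powR_ge0// ge0_ler_powR ?nnegrE ?addr_ge0//.
  have -> : 3 = `|(x + y) + (2 *: x - y)|.
    have -> : (x + y) + (2 *: x - y) = 3 *: x.
      by rewrite addrACA subrr addr0 -{1}(scale1r x) -scalerDl; congr (_ *: _); ring.
    by rewrite normrZ x1 mulr1 ger0_norm.
  exact: ler_normD.
- apply: ge_ereal_sup => _ [x [y [x1 y1 xy1 ->]]].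
  have le2 (u v : X) : `|u| = 1 -> `|v| = 1 -> `|u + v| `^ p <= 2 `^ p.
    move=> u1 v1; rewrite ge0_ler_powR ?nnegrE//.
    by apply: le_trans (ler_normD _ _) _; rewrite u1 v1.
  rewrite lee_fin powRD ?pnatr_eq0 ?implybT// powRr1// mulr_natr mulr2n.
  by rewrite split2; apply: lerD; apply: le2.
Qed.
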